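(* The Burgers flow $(\Phi^t_{\mathcal B})_{t\ge 0}$ on $L^2([0,1])$ with external force $2\partial_xV$ has exactly one steady state, namely $$s_0(x)=-2\,\frac{\partial_xe_0(x)}{e_0(x)},$$ and this steady state is a sink attracting all orbits: for every $u_0\in L^2([0,1])$, $\Phi^t_{\mathcal B}(u_0)\to s_0$ in $L^2([0,1])$ as $t\to\infty$.
   Context: $V:[0,1]\to\mathbb{R}$ is a fixed smooth, strictly positive function. The Burgers flow $\Phi^t_{\mathcal B}$ on $L^2([0,1])$ is defined by $\Phi^t_{\mathcal B}(u_0)=u(t,\cdot)$, where $u$ is the solution (continuous in $t\ge0$ with values in $L^2([0,1])$, infinitely differentiable in $x$ and satisfying the equation and boundary conditions classically for $t>0$) of $$\partial_tu+u\,\partial_xu=\partial^2_{xx}u+2\partial_xV,\qquad u(t,0)=u(t,1)=0,\qquad u(0,x)=u_0(x).$$ A steady state is an $s\in L^2([0,1])$ with $\Phi^t_{\mathcal B}(s)=s$ for all $t\ge 0$. The operator $A=-\partial^2_{xx}+V$ on $[0,1]$ with Neumann boundary conditions is self-adjoint, with eigenvalues $0<\mu_0<\mu_1\le\mu_2\le\dots$; $e_0$ is the eigenfunction for $\mu_0$: $-\partial_{xx}^2e_0+Ve_0=\mu_0e_0$, $\partial_xe_0(0)=\partial_xe_0(1)=0$, normalized by $\|e_0\|_{L^2}=1$ and $e_0>0$ on $[0,1]$. *)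

(* Defs.v *)
From HB Require Import structures.
From mathcomp Require Import all_boot all_order all_algebra.
From mathcomp Require Import all_classical all_reals all_analysis.

Set Implicit Arguments.
Unset Strict Implicit.
Unset Printing Implicit Defensive.

Import Order.TTheory GRing.Theory Num.Theory.
Import numFieldNormedType.Exports.

Local Open Scope classical_set_scope.
Local Open Scope ring_scope.

(* A function on [0, 1] is represented by a function on the whole of R; only
   its values on [0, 1] matter in every definition below. *)

Definition mu01 (R : realType) : {measure set (measurableTypeR R) -> \bar R} :=
  mrestr (@lebesgue_measure R) (measurable_itv `[0%R, 1%R]).

(* Elements are almost-everywhere classes; they coerce to functions through a
   chosen representative. *)
Definition L2 (R : realType) := LspaceType2 (mu01 R).

Definition L2norm (R : realType) (f : R -> R) : \bar R :=
  ('N[mu01 R]_2[EFin \o f])%E.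

(* The filter stays inside [0, 1], so that the derivative is two-sided at
   interior points and one-sided at 0 and 1. *)
Definition derivable01 (R : realType) (f : R -> R) (x : R) : Prop :=
  cvg ((f y - f x) / (y - x) @[y --> within `[0, 1] x^']).

Definition D01 (R : realType) (f : R -> R) (x : R) : R :=
  lim ((f y - f x) / (y - x) @[y --> within `[0, 1] x^']).

Definition smooth01 (R : realType) (f : R -> R) : Prop :=
  forall (n : nat) (x : R), x \in `[0, 1] ->
    derivable01 (iter n (@D01 R) f) x.

Record neumann_eigenpair (R : realType) (V : R -> R) (mu : R) (e : R -> R)
    : Prop := NeumannEigenpair {
  eigenpair_neq0 : exists2 x : R, x \in `[0, 1] & e x != 0 ;
  eigenpair_derivable : forall x : R, x \in `[0, 1] ->
    derivable01 e x /\ derivable01 (D01 e) x ;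
  eigenpair_eq : forall x : R, x \in `[0, 1] ->
    - D01 (D01 e) x + V x * e x = mu * e x ;
  eigenpair_bc : D01 e 0 = 0 /\ D01 e 1 = 0
}.

Record ground_state (R : realType) (V : R -> R) (mu0 : R) (e0 : R -> R)
    : Prop := GroundState {
  ground_eigenpair : neumann_eigenpair V mu0 e0 ;
  ground_lowest : forall mu e, neumann_eigenpair V mu e -> mu0 <= mu ;
  ground_normalized : L2norm e0 = 1%E ;
  ground_gt0 : forall x : R, x \in `[0, 1] -> 0 < e0 x
}.

(* The equation is required classically for t > 0: the derivatives occurring
   in it exist and are continuous in (t, x) on ]0, +oo[ x [0, 1]. *)
Record burgers_classical (R : realType) (V : R -> R) (v : R -> R -> R)
    : Prop := BurgersClassical {
  burgers_smooth : forall t : R, 0 < t -> smooth01 (v t) ;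
  burgers_derivable_t : forall t x : R, 0 < t -> x \in `[0, 1] ->
    derivable (v^~ x) t 1 ;
  burgers_continuous :
    let Q := `]0, +oo[ `*` `[0, 1] : set (R * R) in
    [/\ {within Q, continuous (fun p => v p.1 p.2)},
        {within Q, continuous (fun p => derive1 (v^~ p.2) p.1)},
        {within Q, continuous (fun p => D01 (v p.1) p.2)} &
        {within Q, continuous (fun p => D01 (D01 (v p.1)) p.2)}] ;
  burgers_eq : forall t x : R, 0 < t -> x \in `[0, 1] ->
    derive1 (v^~ x) t + v t x * D01 (v t) x = D01 (D01 (v t)) x + 2 * D01 V x ;
  burgers_bc : forall t : R, 0 < t -> v t 0 = 0 /\ v t 1 = 0
}.

Record burgers_solution (R : realType) (V : R -> R) (u0 : L2 R) (u : R -> L2 R)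
    : Prop := BurgersSolution {
  burgers_init : u 0 = u0 ;
  burgers_L2_continuous : forall t : R, 0 <= t ->
    L2norm (u s \- u t) @[s --> within `[0, +oo[ (nbhs t)] --> 0%E ;
  burgers_pointwise : exists2 v : R -> R -> R,
    forall t : R, 0 < t -> u t = v t %[ae mu01 R] & burgers_classical V v
}.

(* "Phi^t u0 = u(t), where u is the solution issued from u0": the solutions
   issued from u0 are exactly the curves that coincide with the orbit of u0
   for nonnegative times. *)
Definition burgers_flow (R : realType) (V : R -> R) (Phi : R -> L2 R -> L2 R)
    : Prop :=
  forall (u0 : L2 R) (u : R -> L2 R),
    burgers_solution V u0 u <-> (forall t : R, 0 <= t -> u t = Phi t u0).

Definition steady_state (R : realType) (Phi : R -> L2 R -> L2 R) (s : L2 R)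
    : Prop :=
  forall t : R, 0 <= t -> Phi t s = s.

(* Main.v *)
Require Import Defs.
From HB Require Import structures.
From mathcomp Require Import all_boot all_order all_algebra.
From mathcomp Require Import all_classical all_reals all_analysis.
From mathcomp Require Import measurable_realfun ring lra.

Set Implicit Arguments.
Unset Strict Implicit.
Unset Printing Implicit Defensive.

Import Order.TTheory GRing.Theory Num.Theory.
Import numFieldNormedType.Exports.

Local Open Scope classical_set_scope.
Local Open Scope ring_scope.

(* For a solution v, write w = v - s0 and rho = e0^2, so that rho' = - s0 rho.
   The Burgers equation becomes the conservation law w_t = - 2 q_x with
   q = (v^2 - s0^2) / 4 - (v_x - s0') / 2. The Cole-Hopf potential
   P = exp (- 1/2 int_0^x w) then has the flux J = rho P_x = - rho w P / 2, which
   vanishes at 0 and 1, and satisfies J_x = rho P q and P_t = P (q - q(t, 0)).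
   Hence K = int rho P and E = 4 int J^2 / rho = int rho w^2 P^2 evolve by
   K' = - q(t, 0) K and E' = - 8 int rho P^2 q^2 - 2 q(t, 0) E, and the Poincare
   inequality for J makes E / K^2 decay exponentially. Since the oscillation of
   P / K is controlled by E / K^2, P / K is eventually bounded below, and
   int w^2 <= C E / K^2 tends to 0.

   Conversely s0 solves the Riccati equation s0' = s0^2 / 2 - 2 (V - mu0), so it
   is smooth and gives a constant solution; any steady state is within distance
   0 of s0 by the convergence. *)

(* The extension [g] may depend on [x]: it reduces one-sided differentiation at
   the endpoints to the two-sided calculus of the library. *)
Definition is_D01 (R : realType) (f : R -> R) (x l : R) : Prop :=
  exists2 g : R -> R, {in `[0, 1], f =1 g} & is_derive x 1 g l.

Definition diff01 (R : realType) (f : R -> R) : Prop :=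
  forall x, x \in `[0, 1] -> exists l, is_D01 f x l.

(** * Calculus on the unit interval *)

Section D01_calculus.
Context {R : realType}.
Implicit Types (f g h : R -> R) (x y l m : R).

Lemma is_D01_cvg f x l : x \in `[0, 1] -> is_D01 f x l ->
  (f y - f x) / (y - x) @[y --> within `[0, 1] x^'] --> l.
Proof.
move=> xI [g fg [dg <-]].
have H : (g y - g x) / (y - x) @[y --> x^'] --> 'D_1 g x.
  have := dg; rewrite /derivable /derive => /cvg_ex[k hk].
  have -> : lim (h^-1 *: ((g \o shift x) (h *: 1) - g x) @[h --> 0^']) = k.
    exact: cvg_lim hk.
  apply/cvgrPdist_lt => e e0.
  move/cvgrPdist_lt : hk => /(_ _ e0)[d /= d0 hd].
  exists d => //= y /= xyd yx.
  have := hd (y - x); rewrite /= /shift /= scaler1 mulrC /=.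
  rewrite subrK; apply; last by rewrite subr_eq0.
  by rewrite sub0r normrN distrC.
have H2 : (g y - g x) / (y - x) @[y --> within `[0, 1] x^'] --> 'D_1 g x.
  exact: cvg_within_filter H.
apply: cvg_trans H2; apply: near_eq_cvg.
near=> y.
by rewrite !fg//; near: y; exact: withinT.
Unshelve. all: by end_near. Qed.

Lemma dnbhs01_proper x : x \in `[0, 1] -> ProperFilter (within `[0, 1] x^').
Proof.
move=> xI; apply: Build_ProperFilter_ex => A [e /= e0 He].
move: (xI); rewrite in_itv /= => /andP[x0 x1].
(* A step of at most 1/2 towards the farther endpoint stays inside the interval. *)
have [x2|x2] := ltP x 2^-1.
  exists (x + Num.min (e / 2) 2^-1).
  have m0 : 0 < Num.min (e / 2) 2^-1 by rewrite lt_min invr_gt0 divr_gt0//= ltr0n.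
  have m1 : Num.min (e / 2) 2^-1 <= 2^-1 by rewrite ge_min lexx orbT.
  have m2 : Num.min (e / 2) 2^-1 <= e / 2 by rewrite ge_min lexx.
  apply: He => /=.
  - by rewrite opprD addNKr normrN gtr0_norm//; lra.
  - by rewrite gt_eqF//; lra.
  - by rewrite in_itv/=; apply/andP; split; lra.
exists (x - Num.min (e / 2) 2^-1).
have m0 : 0 < Num.min (e / 2) 2^-1 by rewrite lt_min invr_gt0 divr_gt0//= ltr0n.
have m1 : Num.min (e / 2) 2^-1 <= 2^-1 by rewrite ge_min lexx orbT.
have m2 : Num.min (e / 2) 2^-1 <= e / 2 by rewrite ge_min lexx.
apply: He => /=.
- by rewrite opprB addrCA subrr addr0 gtr0_norm//; lra.
- by rewrite lt_eqF//; lra.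
- by rewrite in_itv/=; apply/andP; split; lra.
Qed.

Lemma cvg_is_D01 f x l : x \in `[0, 1] ->
  (f y - f x) / (y - x) @[y --> within `[0, 1] x^'] --> l -> is_D01 f x l.
Proof.
move=> xI fl.
(* Outside the interval the extension is the line of slope [l] through [(x, f x)], whose difference
   quotients at [x] are exactly [l]. *)
exists (fun y => if y \in `[0, 1] then f y else f x + l * (y - x)).
  by move=> y ->.
set g := fun y => _.
have gl : h^-1 *: ((g \o shift x) (h *: 1) - g x) @[h --> 0^'] --> l.
  apply/cvgrPdist_lt => e e0.
  move/cvgrPdist_lt : fl => /(_ _ e0)[d /= d0 hd].
  exists d => // h /= + h0.
  rewrite sub0r normrN => hlt.
  rewrite /g /shift /= xI scaler1.
  case: ifPn => hx.
    have := hd (h + x); rewrite /= addrK mulrC; apply => //.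
      by rewrite opprD addrCA subrr addr0 normrN.
    by rewrite -subr_eq0 addrK.
  by rewrite addrK [X in _^-1 *: X]addrC addKr mulrC scalerA mulVf// scale1r subrr normr0.
have dg : derivable g x 1 by apply/cvg_ex; exists l.
by split => //; exact: cvg_lim gl.
Qed.

Lemma is_D01_unique f x l : x \in `[0, 1] -> is_D01 f x l ->
  derivable01 f x /\ D01 f x = l.
Proof.
move=> xI /(is_D01_cvg xI) fl; have ? := dnbhs01_proper xI.
by split; [apply/cvg_ex; exists l|exact: cvg_lim fl].
Qed.

Lemma D01E f x l : x \in `[0, 1] -> is_D01 f x l -> D01 f x = l.
Proof. by move=> xI /(is_D01_unique xI)[]. Qed.

Lemma derivable01P f x : x \in `[0, 1] ->
  derivable01 f x <-> is_D01 f x (D01 f x).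
Proof.
move=> xI; split => [df|/(is_D01_unique xI)[]//].
exact: cvg_is_D01.
Qed.

Lemma is_D01_diff01 f f' : (forall x, x \in `[0, 1] -> is_D01 f x (f' x)) ->
  diff01 f.
Proof. by move=> H x /H; exists (f' x). Qed.

Lemma eq_is_D01 f g x l : {in `[0, 1], f =1 g} -> is_D01 f x l -> is_D01 g x l.
Proof. by move=> fg [h fh dh]; exists h => // y yI; rewrite -fg// fh. Qed.

Lemma eq_D01 f g x : x \in `[0, 1] -> {in `[0, 1], f =1 g} ->
  D01 f x = D01 g x.
Proof.
move=> xI fg; rewrite /D01; apply: f_equal.
rewrite eqEsubset; split; apply: near_eq_cvg;
  near=> y; rewrite !fg//; near: y; exact: withinT.
Unshelve. all: by end_near. Qed.

Lemma is_derive_is_D01 f x l : is_derive x 1 f l -> is_D01 f x l.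
Proof. by exists f. Qed.

Lemma is_D01_cst c x : is_D01 (fun=> c) x 0.
Proof. by apply: is_derive_is_D01; exact: is_derive_cst. Qed.

Lemma is_D01_id x : is_D01 id x 1.
Proof. by apply: is_derive_is_D01; exact: is_derive_id. Qed.

Lemma is_D01D f g x l m : is_D01 f x l -> is_D01 g x m ->
  is_D01 (fun y => f y + g y) x (l + m).
Proof.
move=> [f1 e1 d1] [g1 e2 d2]; exists (f1 \+ g1); last exact: is_deriveD.
by move=> y yI /=; rewrite e1// e2.
Qed.

Lemma is_D01M f g x l m : x \in `[0, 1] -> is_D01 f x l -> is_D01 g x m ->
  is_D01 (fun y => f y * g y) x (l * g x + f x * m).
Proof.
move=> xI [f1 e1 d1] [g1 e2 d2]; exists (f1 \* g1).
  by move=> y yI /=; rewrite e1// e2.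
rewrite e1// e2//.
by apply: is_derive_eq; rewrite addrC; congr (_ + _); rewrite /GRing.scale /= mulrC.
Qed.

Lemma is_D01_comp f g x l m : x \in `[0, 1] -> is_derive (f x) 1 g m ->
  is_D01 f x l -> is_D01 (fun y => g (f y)) x (m * l).
Proof.
move=> xI dg [f1 e1 d1]; exists (g \o f1).
  by move=> y yI /=; rewrite e1.
by rewrite e1// in dg; apply: is_derive1_comp.
Qed.

Lemma is_D01N f x l : is_D01 f x l -> is_D01 (fun y => - f y) x (- l).
Proof.
move=> [f1 e1 d1]; exists (fun y => - f1 y); last exact: is_deriveN.
by move=> y yI /=; rewrite e1.
Qed.

Lemma is_D01V f x l : x \in `[0, 1] -> f x != 0 -> is_D01 f x l ->
  is_D01 (fun y => (f y)^-1) x (- l / f x ^+ 2).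
Proof.
move=> xI f0 df; rewrite mulNr mulrC -mulNr.
apply: (@is_D01_comp f (fun z => z^-1)) => //.
have := @is_deriveV _ id (f x) 1 1 f0 (is_derive_id _ _).
by rewrite /GRing.scale /= mulr1.
Qed.

Lemma is_D01_eq f x l m : is_D01 f x l -> l = m -> is_D01 f x m.
Proof. by move=> ? <-. Qed.

Lemma is_D01_inner f x l : x \in `]0, 1[ -> is_D01 f x l -> is_derive x 1 f l.
Proof.
move=> xI [g fg dg]; apply: near_eq_is_derive dg.
have := near_in_itvoo xI; apply: filterS => y yI.
by rewrite fg//; apply: subset_itv_oo_cc.
Qed.

Lemma diff01_continuous f : diff01 f -> {within `[0, 1], continuous f}.
Proof.
move=> df; apply/subspace_continuousP => x /= xI.
have [l [g fg [dg _]]] := df _ xI.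
suff : f @ within `[0, 1] (nbhs x) --> g x by rewrite -fg.
apply: (@cvg_trans _ (g @ within `[0, 1] (nbhs x))); last first.
  apply: cvg_within_filter.
  apply: (@differentiable_continuous R R^o R^o x g).
  by apply/derivable1_diffP.
apply: near_eq_cvg; near=> y; rewrite fg//; near: y; exact: withinT.
Unshelve. all: by end_near. Qed.

Lemma diff01D f g : diff01 f -> diff01 g -> diff01 (fun x => f x + g x).
Proof.
by move=> df dg x xI; have [l fl] := df _ xI; have [m gm] := dg _ xI;
  exists (l + m); exact: is_D01D.
Qed.

Lemma diff01M f g : diff01 f -> diff01 g -> diff01 (fun x => f x * g x).
Proof.
by move=> df dg x xI; have [l fl] := df _ xI; have [m gm] := dg _ xI;
  eexists; exact: is_D01M fl gm.
Qed.

Lemma diff01N f : diff01 f -> diff01 (fun x => - f x).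
Proof. by move=> df x xI; have [l fl] := df _ xI; eexists; exact: is_D01N fl. Qed.

Lemma diff01_cst c : diff01 (fun=> c : R).
Proof. by move=> x xI; exists 0; exact: is_D01_cst. Qed.

Lemma diff01X f n : diff01 f -> diff01 (fun x => f x ^+ n).
Proof.
move=> df; elim: n => [|n IH]; first exact: diff01_cst.
by rewrite (_ : (fun x => _) = (fun x => f x * f x ^+ n)); [exact: diff01M|
  apply/funext => x; rewrite exprS].
Qed.

Lemma is_D01_ndecr f f' : (forall x, x \in `[0, 1] -> is_D01 f x (f' x)) ->
  (forall x, x \in `[0, 1] -> 0 <= f' x) ->
  forall x y, 0 <= x -> x <= y -> y <= 1 -> f x <= f y.
Proof.
move=> df f'0; apply: ger0_derive1_ndecr => [x xI|x xI|].
- by have [] := is_D01_inner xI (df _ (subset_itv_oo_cc xI)).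
- have [dx e] := is_D01_inner xI (df _ (subset_itv_oo_cc xI)).
  by rewrite derive1E e f'0//; exact: subset_itv_oo_cc.
- by apply: diff01_continuous; exact: is_D01_diff01 df.
Qed.

Lemma is_D01_const f : (forall x, x \in `[0, 1] -> is_D01 f x 0) ->
  forall x, x \in `[0, 1] -> f x = f 0.
Proof.
move=> df x; rewrite in_itv/= => /andP[x0 x1]; apply/eqP; rewrite eq_le.
rewrite (@is_D01_ndecr f (fun=> 0) df _ 0 x)// andbT -lerN2.
apply: (@is_D01_ndecr (fun x => - f x) (fun=> 0)) => // y yI.
by rewrite -oppr0; exact/is_D01N/df.
Qed.

End D01_calculus.

(** * Primitives and integrals on the unit interval *)

Definition prim01 (R : realType) (f : R -> R) (x : R) : R :=
  \int[@lebesgue_measure R]_(y in `[0, x]) f y.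

Section primitive.
Context {R : realType}.
Implicit Types (f g G : R -> R) (x y : R).
Local Notation mu := (@lebesgue_measure R).

Lemma diff01_integrable f x : x \in `[0, 1] -> diff01 f ->
  mu.-integrable `[0, x] (EFin \o f).
Proof.
move=> xI /diff01_continuous cf.
apply: continuous_compact_integrable; first exact: segment_compact.
apply: continuous_subspaceW cf; apply: subset_itvl.
by move: xI; rewrite in_itv bnd_simp => /andP[].
Qed.

(** Composing with the projection onto [[0, 1]] gives a globally continuous extension, so the
    fundamental theorem of calculus applies at 0 and 1 as at interior points. *)
Lemma continuous_clamp01 f : {within `[0, 1], continuous f} ->
  continuous (fun y => f (Num.max 0 (Num.min y 1))).
Proof.
move=> /subspace_continuousP cf y.
set c := fun z : R => Num.max 0 (Num.min z 1).
have cI z : `[0, 1]%classic (c z).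
  rewrite /= in_itv /= /c le_max lexx /= ge_max ler01 /=.
  by rewrite ge_min lexx orbT.
have cc : c @ y --> c y.
  apply: (@continuous_max R R (fun=> 0) (fun z => Num.min z 1) y).
    exact: cst_continuous.
  apply: (@continuous_min R R id (fun=> 1) y); first exact: cvg_id.
  exact: cst_continuous.
apply: (@cvg_comp _ _ _ c f _ (within `[0, 1] (nbhs (c y)))).
  move=> A /= hA.
  have h : \forall z \near y, `[0, 1]%classic (c z) -> A (c z) by exact: cc hA.
  by apply: filterS h => z; apply.
exact: cf.
Qed.

Lemma prim01_0 f : prim01 f 0 = 0.
Proof. by rewrite /prim01 set_itv1 Rintegral_set1. Qed.

Lemma is_D01_prim f x : diff01 f -> x \in `[0, 1] ->
  is_D01 (prim01 f) x (f x).
Proof.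
move=> df xI.
have cf := continuous_clamp01 (diff01_continuous df).
set fc := fun y : R => f (Num.max 0 (Num.min y 1)).
have fcE y : y \in `[0, 1] -> fc y = f y.
  rewrite in_itv /= => /andP[y0 y1]; rewrite /fc.
  by rewrite (min_idPl y1) (max_idPr y0).
have ifc b : mu.-integrable `[-1, b] (EFin \o fc).
  apply: continuous_compact_integrable; first exact: segment_compact.
  by apply: continuous_subspaceT.
(* Integrating from -1, with room up to 2, makes every point of [[0, 1]] interior; [F - F 0] is then
   the two-sided extension of [prim01 f]. *)
pose F y := \int[mu]_(z in `[-1, y]) fc z.
have [x0 x1] : 0 <= x /\ x <= 1 by move: xI; rewrite in_itv/= => /andP[].
have [||||dF F'] := @continuous_FTC1_closed _ fc (-1) x 2.
- lra.
- exact: ifc.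
- lra.
- exact: cf.
exists (fun y => F y - F 0).
  move=> y yI; rewrite /prim01 /F.
  have y0 : 0 <= y by move: yI; rewrite in_itv/= => /andP[].
  rewrite (@Rintegral_itvB _ fc (BLeft (-1)) (BRight y) 0).
  - rewrite Rintegral_itv_obnd_cbnd; last first.
      apply: integrableS (ifc y) => //.
      by apply: subset_itvr; rewrite bnd_simp; lra.
    apply: eq_Rintegral => z; rewrite inE /= in_itv /= => /andP[z0 zy].
    rewrite fcE// in_itv /= z0 (le_trans zy)//.
    by move: yI; rewrite in_itv/= => /andP[].
  - exact: ifc.
  - by rewrite bnd_simp; lra.
  - by rewrite bnd_simp.
have dFx : is_derive x 1 F (fc x).
  by rewrite -F' derive1E; exact: derivableP.
rewrite -(fcE _ xI) -[fc x]subr0.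
by apply: is_deriveB.
Qed.

Lemma prim01_FTC f G x : diff01 f -> (forall y, y \in `[0, 1] -> is_D01 G y (f y)) ->
  x \in `[0, 1] -> prim01 f x = G x - G 0.
Proof.
move=> df dG xI; apply/eqP; rewrite -subr_eq0 opprB addrA addrAC; apply/eqP.
rewrite (@is_D01_const _ (fun y => prim01 f y - G y) _ x xI).
  by rewrite prim01_0; ring.
move=> y yI; rewrite -(subrr (f y)); apply: is_D01D; first exact: is_D01_prim.
exact/is_D01N/dG.
Qed.

Lemma ler_prim01 f g x : diff01 f -> diff01 g -> x \in `[0, 1] ->
  (forall y, y \in `[0, 1] -> f y <= g y) -> prim01 f x <= prim01 g x.
Proof.
move=> df dg xI fg; apply: le_Rintegral => //.
- exact: diff01_integrable.
- exact: diff01_integrable.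
- move=> y; rewrite /= in_itv/= => /andP[y0 yx]; apply: fg.
  by move: xI; rewrite !in_itv/= y0 => /andP[_]; exact: le_trans.
Qed.

Lemma prim01_ge0 f x : x \in `[0, 1] ->
  (forall y, y \in `[0, 1] -> 0 <= f y) -> 0 <= prim01 f x.
Proof.
move=> xI f0; apply: Rintegral_ge0.
move=> y; rewrite /= in_itv/= => /andP[y0 yx]; apply: f0.
by move: xI; rewrite !in_itv/= y0 => /andP[_]; exact: le_trans.
Qed.

Lemma prim01D f g x : diff01 f -> diff01 g -> x \in `[0, 1] ->
  prim01 (fun y => f y + g y) x = prim01 f x + prim01 g x.
Proof. by move=> df dg xI; rewrite /prim01 RintegralD//; exact: diff01_integrable. Qed.

Lemma prim01Z c f x : diff01 f -> x \in `[0, 1] ->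
  prim01 (fun y => c * f y) x = c * prim01 f x.
Proof. by move=> df xI; rewrite /prim01 RintegralZl//; exact: diff01_integrable. Qed.

Lemma prim01_cst c x : x \in `[0, 1] -> prim01 (fun=> c) x = c * x.
Proof.
move=> xI; rewrite (@prim01_FTC _ (fun y => c * y))//.
- by rewrite mulr0 subr0.
- exact: diff01_cst.
- move=> y yI; apply: is_D01_eq (is_D01M yI (is_D01_cst c y) (is_D01_id y)) _.
  by rewrite mul0r add0r mulr1.
Qed.

Lemma prim01_ndecr f x y : diff01 f -> (forall y, y \in `[0, 1] -> 0 <= f y) ->
  0 <= x -> x <= y -> y <= 1 -> prim01 f x <= prim01 f y.
Proof.
by move=> df f0; exact: (is_D01_ndecr (fun z zI => is_D01_prim df zI) f0).
Qed.

End primitive.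

(** * Differentiation under the integral sign *)

Section time.
Context {R : realType}.
Implicit Types (f g : R -> R -> R) (t x : R).
Local Notation mu := (@lebesgue_measure R).

Definition locally_bounded01 f := forall t, 0 < t ->
  exists C, \forall s \near t, forall x, x \in `[0, 1] -> `|f s x| <= C.

(* The local bounds, uniform in [x], are what dominated convergence needs to
   differentiate under the integral sign; unlike joint continuity, they are
   trivially stable under products, exponentials and primitives. *)
Record time_derivative f g : Prop := TimeDerivative {
  time_derivative_diff : forall t, 0 < t -> diff01 (f t) ;
  time_derivative_is_derive : forall t x, 0 < t -> x \in `[0, 1] ->
    is_derive t 1 (f^~ x) (g t x) ;
  time_derivative_bounded : locally_bounded01 f ;
  time_derivative_bounded' : locally_bounded01 g }.

Lemma locally_bounded01D f g : locally_bounded01 f -> locally_bounded01 g ->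
  locally_bounded01 (fun t x => f t x + g t x).
Proof.
move=> bf bg t t0; have [C hC] := bf _ t0; have [D hD] := bg _ t0.
exists (C + D); near=> s => x xI; rewrite (le_trans (ler_normD _ _))// lerD//.
  by move: x xI; near: s.
by move: x xI; near: s.
Unshelve. all: by end_near. Qed.

Lemma locally_bounded01M f g : locally_bounded01 f -> locally_bounded01 g ->
  locally_bounded01 (fun t x => f t x * g t x).
Proof.
move=> bf bg t t0; have [C hC] := bf _ t0; have [D hD] := bg _ t0.
exists (C * D); near=> s => x xI; rewrite normrM ler_pM//.
  by move: x xI; near: s.
by move: x xI; near: s.
Unshelve. all: by end_near. Qed.

Lemma time_derivativeM f f' g g' : time_derivative f f' ->
  time_derivative g g' ->
  time_derivative (fun t x => f t x * g t x)
    (fun t x => f' t x * g t x + f t x * g' t x).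
Proof.
move=> [df ff bf bf'] [dg gg bg bg']; split.
- by move=> t t0; apply: diff01M; [exact: df|exact: dg].
- move=> t x t0 xI; have h1 := ff _ _ t0 xI; have h2 := gg _ _ t0 xI.
  have := is_deriveM h1 h2; rewrite /GRing.scale /= addrC [g t x * _]mulrC.
  exact.
- exact: locally_bounded01M.
- by apply: locally_bounded01D; exact: locally_bounded01M.
Qed.

Lemma time_derivative_cst (h : R -> R) : diff01 h ->
  time_derivative (fun=> h) (fun _ _ => 0).
Proof.
move=> dh; split => //.
- by move=> t x _ _; exact: is_derive_cst.
- move=> t t0; have /compact_bounded[M [_ hM]] : compact (h @` `[0, 1]).
    apply: continuous_compact; last exact: segment_compact.
    exact: diff01_continuous.
  exists (M + 1); near=> s => x xI.
  by apply: (hM (M + 1)); [rewrite ltrDl|exists x].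
- by move=> t t0; exists 0; near=> s => x xI; rewrite normr0.
Unshelve. all: by end_near. Qed.

Lemma time_derivative_exp f g : time_derivative f g ->
  time_derivative (fun t x => expR (f t x)) (fun t x => expR (f t x) * g t x).
Proof.
move=> [df ff bf bg].
have be : locally_bounded01 (fun t x => expR (f t x)).
  move=> t t0; have [C hC] := bf _ t0; exists (expR C); near=> s => x xI.
  rewrite gtr0_norm ?expR_gt0// ler_expR (le_trans (ler_norm _))//.
  by move: x xI; near: s.
split => //.
- move=> t t0 x xI; have [l fl] := df _ t0 _ xI.
  by eexists; apply: (is_D01_comp (g := expR)) fl => //; exact: is_derive_expR.
- by move=> t x t0 xI; apply: is_derive1_comp; exact: ff.
- exact: locally_bounded01M.
Unshelve. all: by end_near. Qed.

Lemma prim01_bounded (h : R -> R) C x : diff01 h ->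
  (forall y, y \in `[0, 1] -> `|h y| <= C) -> x \in `[0, 1] ->
  `|prim01 h x| <= C.
Proof.
move=> dh hC xI.
have C0 : 0 <= C by apply: le_trans (hC x xI).
have [x0 x1] : 0 <= x /\ x <= 1 by move: xI; rewrite in_itv/= => /andP[].
rewrite ler_norml; apply/andP; split.
  apply: (@le_trans _ _ (prim01 (fun=> - C) x)).
    by rewrite prim01_cst// mulNr lerN2 ler_piMr.
  apply: ler_prim01 => //; first exact: diff01_cst.
  by move=> y /hC; rewrite ler_norml => /andP[].
apply: (@le_trans _ _ (prim01 (fun=> C) x)).
  apply: ler_prim01 => //; first exact: diff01_cst.
  by move=> y /hC; rewrite ler_norml => /andP[].
by rewrite prim01_cst// ler_piMr.
Qed.

(** Dominated convergence: on a short time window the bound on [g], uniform in space, is a constant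
    and therefore integrable over [[0, x]]. *)
Lemma time_derivative_prim f g : time_derivative f g ->
  (forall t, 0 < t -> diff01 (g t)) ->
  time_derivative (fun t => prim01 (f t)) (fun t => prim01 (g t)).
Proof.
move=> [df ff bf bg] dg; split.
- by move=> t t0 x xI; exists (f t x); apply: is_D01_prim => //; exact: df.
- move=> t x t0 xI.
  have [C hC] := bg _ t0.
  have [e /= e0 he] : \forall s \near t, 0 < s /\
      forall x, x \in `[0, 1] -> `|g s x| <= C.
    by near=> s; split; near: s => //; exact: lt_nbhsr.
  have sub s : `]t - e, t + e[%classic s -> 0 < s /\
      forall x, x \in `[0, 1] -> `|g s x| <= C.
    rewrite /= in_itv /= => se; apply: he => /=.
    by rewrite ltr_distlC.
  have sub01 y : `[0, x]%classic y -> y \in `[0, 1].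
    rewrite /= !in_itv /= => /andP[y0 yx]; rewrite y0 (le_trans yx)//.
    by move: xI; rewrite in_itv/= => /andP[].
  have p1E s y : `]t - e, t + e[%classic s -> `[0, x]%classic y ->
      partial1of2 f s y = g s y.
    move=> /sub[s0 _] /sub01 yI; rewrite partial1of2E.
    by have [_ ->] := ff _ _ s0 yI.
  have tI : `]t - e, t + e[%classic t by rewrite /= in_itv/=; lra.
  have C0 : 0 <= C.
    apply: le_trans (normr_ge0 (g t 0)) _.
    by apply: (sub t tI).2; rewrite in_itv/= lexx ler01.
  have H1 s : `]t - e, t + e[%classic s ->
      mu.-integrable `[0, x] (EFin \o f s).
    by move=> /sub[s0 _]; apply: diff01_integrable => //; exact: df.
  have H2 s y : `]t - e, t + e[%classic s -> `[0, x]%classic y ->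
      derivable (f^~ y) s 1.
    by move=> /sub[s0 _] /sub01 yI; have [] := ff _ _ s0 yI.
  have H3 : mu.-integrable `[0, x] (EFin \o (fun=> C)).
    by apply: diff01_integrable => //; exact: diff01_cst.
  have H4 s y : `]t - e, t + e[%classic s -> `[0, x]%classic y ->
      `|partial1of2 f s y| <= C.
    by move=> sI yI; rewrite p1E//; apply: (sub s sI).2; exact: sub01.
  have mI : measurable (`[0, x] : set R) by [].
  have dF := @derivable_under_integral R _ _ mu f _ mI t _ _ tI H1 H2 _
    (fun=> C0) H3 H4.
  have F' := @differentiation_under_integral R _ _ mu f _ mI t _ _ tI H1 H2 _
    (fun=> C0) H3 H4.
  rewrite (_ : prim01 (g t) x = \int[mu]_(y in `[0, x]) partial1of2 f t y).
    by rewrite -F' derive1E; exact: derivableP.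
  by apply: eq_Rintegral => y; rewrite inE => yI; rewrite p1E.
- move=> t t0; have [C hC] := bf _ t0; exists C; near=> s => x xI.
  apply: prim01_bounded => //; first by apply: df; near: s; exact: lt_nbhsr.
  by near: s.
- move=> t t0; have [C hC] := bg _ t0; exists C; near=> s => x xI.
  apply: prim01_bounded => //; first by apply: dg; near: s; exact: lt_nbhsr.
  by near: s.
Unshelve. all: by end_near. Qed.

End time.

(** * Pointwise and oscillation bounds by the energy of the derivative *)

Section static_inequalities.
Context {R : realType}.
Implicit Types (f j : R -> R) (x y : R).

Lemma in01_0 : (0 : R) \in `[0, 1].
Proof. by rewrite in_itv/= lexx ler01. Qed.

Lemma in01_1 : (1 : R) \in `[0, 1].
Proof. by rewrite in_itv/= lexx ler01. Qed.

(** A Cauchy-Schwarz estimate for functions vanishing at 0; applied to the flux [J] it serves as the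
    Poincare inequality. *)
Lemma sqr_le_prim01 f j x : (forall y, y \in `[0, 1] -> is_D01 f y (j y)) ->
  diff01 j -> f 0 = 0 -> x \in `[0, 1] ->
  f x ^+ 2 <= prim01 (fun y => j y ^+ 2) 1.
Proof.
move=> df dj f0 xI.
have [x0 x1] : 0 <= x /\ x <= 1 by move: xI; rewrite in_itv/= => /andP[].
have dj2 : diff01 (fun y => j y ^+ 2) by exact: diff01X.
(* [(j - f x)^2 >= 0], integrated over [0, x] *)
set m := f x.
pose G y := prim01 (fun y => j y ^+ 2) y + (- (2 * m) * f y + m ^+ 2 * y).
have dG y : y \in `[0, 1] -> is_D01 G y ((j y - m) ^+ 2).
  move=> yI; apply: is_D01_eq.
    apply: is_D01D; first exact: is_D01_prim.
    apply: is_D01D; first exact: is_D01M (is_D01_cst _ _) (df _ yI).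
    exact: is_D01M (is_D01_cst _ _) (is_D01_id y).
  by rewrite /=; ring.
have := is_D01_ndecr dG (fun y _ => sqr_ge0 _) (lexx 0) x0 x1.
rewrite /G prim01_0 f0 => h.
have : prim01 (fun y => j y ^+ 2) x <= prim01 (fun y => j y ^+ 2) 1.
  by apply: prim01_ndecr => // y _; exact: sqr_ge0.
(* [G 0 <= G x] reads [2 m^2 <= int_0^x j^2 + m^2 x], and [x <= 1] absorbs one [m^2]. *)
rewrite -/m in h *; have : m ^+ 2 * x <= m ^+ 2 by rewrite ler_piMr// sqr_ge0.
nra.
Qed.

(** The oscillation is at most the integral of [|j|]. The free parameter [k] replaces the square
    root of Cauchy-Schwarz and is tuned at the point of use. *)
Lemma osc_le_prim01 f j k x y : (forall y, y \in `[0, 1] -> is_D01 f y (j y)) ->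
  diff01 j -> 0 < k -> x \in `[0, 1] -> y \in `[0, 1] ->
  f y <= f x + (k + prim01 (fun z => j z ^+ 2) 1 / (4 * k)).
Proof.
move=> df dj k0 xI yI.
have [x0 x1] : 0 <= x /\ x <= 1 by move: xI; rewrite in_itv/= => /andP[].
have [y0 y1] : 0 <= y /\ y <= 1 by move: yI; rewrite in_itv/= => /andP[].
have dj2 : diff01 (fun y => j y ^+ 2) by exact: diff01X.
(* AM-GM: [`|j| <= k + j^2 / (4 k)] *)
pose h z := k + (4 * k)^-1 * j z ^+ 2.
have hE z : h z - j z = (4 * k)^-1 * (j z - 2 * k) ^+ 2.
  by rewrite /h; field; rewrite gt_eqF.
have hE' z : h z + j z = (4 * k)^-1 * (j z + 2 * k) ^+ 2.
  by rewrite /h; field; rewrite gt_eqF.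
have i0 : 0 <= (4 * k)^-1 by rewrite invr_ge0 mulr_ge0// ltW.
have dh : diff01 h.
  by apply: diff01D; [exact: diff01_cst|apply: diff01M => //; exact: diff01_cst].
have h0 z : 0 <= h z by apply: addr_ge0; [exact: ltW|apply: mulr_ge0 => //; exact: sqr_ge0].
have h1 : prim01 h 1 = k + prim01 (fun z => j z ^+ 2) 1 / (4 * k).
  rewrite prim01D ?in01_1//; last 2 first.
  - exact: diff01_cst.
  - by apply: diff01M => //; exact: diff01_cst.
  by rewrite prim01_cst ?in01_1// prim01Z ?in01_1// mulr1 [_^-1 * _]mulrC.
rewrite -h1.
(* Since [|j| <= h], both [prim01 h - f] and [prim01 h + f] are nondecreasing; the order of [x] and
   [y] decides which one is used. *)
have [xy|yx] := leP x y.
  have d z : z \in `[0, 1] -> is_D01 (fun z => prim01 h z - f z) z (h z - j z).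
    by move=> zI; apply: is_D01D; [exact: is_D01_prim|exact/is_D01N/df].
  have := is_D01_ndecr d _ x0 xy y1.
  have H z : z \in `[0, 1] -> 0 <= h z - j z.
    by move=> _; rewrite hE mulr_ge0// sqr_ge0.
  move=> /(_ H) ?.
  have : prim01 h y <= prim01 h 1 by apply: prim01_ndecr.
  have : 0 <= prim01 h x by apply: prim01_ge0.
  lra.
have d z : z \in `[0, 1] -> is_D01 (fun z => prim01 h z + f z) z (h z + j z).
  by move=> zI; apply: is_D01D; [exact: is_D01_prim|exact: df].
have := is_D01_ndecr d _ y0 (ltW yx) x1.
have H z : z \in `[0, 1] -> 0 <= h z + j z.
  by move=> _; rewrite hE' mulr_ge0// sqr_ge0.
move=> /(_ H) ?.
have : prim01 h x <= prim01 h 1 by apply: prim01_ndecr.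
have : 0 <= prim01 h y by apply: prim01_ge0.
lra.
Qed.

End static_inequalities.

Lemma eq_time_derivative (R : realType) (f g h : R -> R -> R) :
  (forall t x, 0 < t -> x \in `[0, 1] -> g t x = h t x) ->
  time_derivative f g -> time_derivative f h.
Proof.
move=> gh [df ff bf bg]; split => //.
- by move=> t x t0 xI; rewrite -gh//; exact: ff.
- move=> t t0; have [C hC] := bg _ t0; exists C; near=> s => x xI.
  rewrite -gh//; last by near: s; exact: lt_nbhsr.
  by move: x xI; near: s.
Unshelve. all: by end_near. Qed.

(** * Decay for the conservation law *)

Section decay.
Context {R : realType} (rho s : R -> R) (w wt q : R -> R -> R) (d M : R).
Hypothesis d_gt0 : 0 < d.
Hypothesis rho_ge : forall x, x \in `[0, 1] -> d <= rho x.
Hypothesis rho_le : forall x, x \in `[0, 1] -> rho x <= M.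
Hypothesis rho_D01 : forall x, x \in `[0, 1] -> is_D01 rho x (- (s x * rho x)).
Hypothesis w_dt : time_derivative w wt.
Hypothesis wt_diff : forall t, 0 < t -> diff01 (wt t).
Hypothesis w_bc : forall t, 0 < t -> w t 0 = 0 /\ w t 1 = 0.
(** With [v = s + w], this is the definition of the flux [q] solved for [w_x]; the next hypothesis
    is the conservation law [w_t = - 2 q_x]. *)
Hypothesis w_D01 : forall t x, 0 < t -> x \in `[0, 1] ->
  is_D01 (w t) x (s x * w t x + w t x ^+ 2 / 2 - 2 * q t x).
Hypothesis q_D01 : forall t x, 0 < t -> x \in `[0, 1] ->
  is_D01 (q t) x (- (wt t x / 2)).

Let p (t x : R) : R := - 2^-1 * prim01 (w t) x.
Let P t x := expR (p t x).
Let J (t x : R) : R := - 2^-1 * (rho x * (w t x * P t x)).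
Let K t := prim01 (fun x => rho x * P t x) 1.
Let E t := prim01 (fun x => rho x * ((w t x * P t x) * (w t x * P t x))) 1.
(** The dissipation: the integral of [J_x^2 / rho], since [J_x = rho P q]. *)
Let G t := prim01 (fun x => rho x * (P t x * q t x) ^+ 2) 1.

Let w_diff t : 0 < t -> diff01 (w t).
Proof. by case: w_dt => + _ _ _; apply. Qed.

Let q_diff t : 0 < t -> diff01 (q t).
Proof. by move=> t0; apply: is_D01_diff01 => x xI; exact: q_D01. Qed.

Let rho_diff : diff01 rho.
Proof. exact: is_D01_diff01 rho_D01. Qed.

Let M_gt0 : 0 < M.
Proof.
by apply: lt_le_trans d_gt0 (le_trans (rho_ge in01_0) (rho_le in01_0)).
Qed.

Let rho_gt0 x : x \in `[0, 1] -> 0 < rho x.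
Proof. by move=> /rho_ge; apply: lt_le_trans. Qed.

Let P_gt0 t x : 0 < P t x.
Proof. exact: expR_gt0. Qed.

Let P_D01 t x : 0 < t -> x \in `[0, 1] ->
  is_D01 (P t) x (- 2^-1 * (w t x * P t x)).
Proof.
move=> t0 xI; apply: is_D01_eq.
  apply: (is_D01_comp (g := expR)) => //.
  apply: is_D01M => //; first exact: is_D01_cst.
  by apply: is_D01_prim => //; exact: w_diff.
by rewrite /= -/(P t x); ring.
Qed.

Let P_diff t : 0 < t -> diff01 (P t).
Proof. by move=> t0; apply: is_D01_diff01 => x xI; exact: P_D01. Qed.

(** Two cancellations leave only [q]: [rho' = - s rho] removes the term in [s w], and
    [P_x = - w P / 2] removes the one in [w^2 / 2]. *)
Let J_D01 t x : 0 < t -> x \in `[0, 1] ->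
  is_D01 (J t) x (rho x * (P t x * q t x)).
Proof.
move=> t0 xI; apply: is_D01_eq.
  apply: is_D01M => //; first exact: is_D01_cst.
  apply: is_D01M => //; first exact: rho_D01.
  apply: is_D01M => //; first exact: w_D01.
  exact: P_D01.
by rewrite /=; field.
Qed.

Let J_bc t : 0 < t -> J t 0 = 0 /\ J t 1 = 0.
Proof. by move=> /w_bc[w0 w1]; rewrite /J w0 w1 !(mul0r, mulr0). Qed.

Let P_dt : time_derivative P (fun t x => P t x * (q t x - q t 0)).
Proof.
have := time_derivative_exp (time_derivativeM
  (time_derivative_cst (diff01_cst (- 2^-1))) (time_derivative_prim w_dt wt_diff)).
apply: eq_time_derivative => t x t0 xI; rewrite -/(P t x); congr (_ * _).
(* Integrating [w_t = - 2 q_x] from 0 to [x] gives [- 2 (q(t, x) - q(t, 0))]; the base point 0 of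
   the primitive is the source of the [q t 0] terms below. *)
rewrite (@prim01_FTC _ (wt t) (fun y => - 2 * q t y) _ (wt_diff t0))//.
  by field.
move=> y yI; apply: is_D01_eq.
  by apply: is_D01M => //; [exact: is_D01_cst|exact: q_D01].
by rewrite /=; field.
Qed.

(** The part [rho P q] of the integrand is [J_x], which integrates to 0 because the flux vanishes at
    both ends; only the [q t 0] term survives. *)
Let K_dt (t : R) : 0 < t -> is_derive t 1 K (- q t 0 * K t).
Proof.
move=> t0.
have dKt := time_derivativeM (time_derivative_cst rho_diff) P_dt.
have d2 r : 0 < r -> diff01 (fun x : R => 0 * P r x + rho x * (P r x * (q r x - q r 0))).
  move=> r0; apply: diff01D; apply: diff01M.
  - exact: diff01_cst.
  - exact: P_diff.
  - exact: rho_diff.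
  - apply: diff01M; first exact: P_diff.
    by apply: diff01D; [exact: q_diff|exact: diff01_cst].
have drP : diff01 (fun x => rho x * P t x).
  by apply: diff01M => //; exact: P_diff.
have [_ + _ _] := time_derivative_prim dKt d2.
move=> /(_ t 1 t0 in01_1).
suff -> : prim01 (fun x => 0 * P t x + rho x * (P t x * (q t x - q t 0))) 1 =
   - q t 0 * K t by [].
rewrite (@prim01_FTC _ _ (fun y => J t y - q t 0 * prim01 (fun x => rho x * P t x) y)).
- have [-> ->] := J_bc t0.
  by rewrite prim01_0 -/(K t); ring.
- exact: d2.
- move=> y yI; apply: is_D01_eq.
    apply: is_D01D; first exact: J_D01.
    apply: is_D01N; apply: is_D01M => //; first exact: is_D01_cst.
    exact: is_D01_prim.
  by rewrite /=; ring.
- exact: in01_1.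
Qed.

Let E_dt (t : R) : 0 < t -> is_derive t 1 E (- 8 * G t - 2 * q t 0 * E t).
Proof.
move=> t0.
have dwP := time_derivativeM w_dt P_dt.
have dEt := time_derivativeM (time_derivative_cst rho_diff) (time_derivativeM dwP dwP).
set g := (X in time_derivative _ X) in dEt.
have d2 r : 0 < r -> diff01 (g r).
  move=> r0; rewrite /g.
  have dr := rho_diff; have dw := w_diff r0; have dw' := wt_diff r0.
  have dP := P_diff r0; have dq := q_diff r0.
  have dP' : diff01 (fun x => P r x * (q r x - q r 0)).
    by apply: diff01M => //; apply: diff01D => //; exact: diff01_cst.
  have dWP' : diff01 (fun x => wt r x * P r x + w r x * (P r x * (q r x - q r 0))).
    by apply: diff01D; apply: diff01M.
  apply: diff01D; apply: diff01M => //.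
  - exact: diff01_cst.
  - by apply: diff01M; exact: diff01M.
  - by apply: diff01D; apply: diff01M => //; exact: diff01M.
have drwP : diff01 (fun x => rho x * ((w t x * P t x) * (w t x * P t x))).
  have dw := w_diff t0; have dP := P_diff t0.
  by apply: diff01M => //; apply: diff01M; exact: diff01M.
have drPq : diff01 (fun x => rho x * (P t x * q t x) ^+ 2).
  have dq := q_diff t0; have dP := P_diff t0.
  by apply: diff01M => //; apply: diff01X; exact: diff01M.
have [_ + _ _] := time_derivative_prim dEt d2.
move=> /(_ t 1 t0 in01_1).
suff -> : prim01 (g t) 1 = - 8 * G t - 2 * q t 0 * E t by [].
(* [E' + 8 G + 2 q(t, 0) E] is the integral of [(8 J P q)_x] *)
rewrite (@prim01_FTC _ _ (fun y => 8 * (J t y * (P t y * q t y)) +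
   (- 8 * prim01 (fun x => rho x * (P t x * q t x) ^+ 2) y +
    - 2 * q t 0 * prim01 (fun x => rho x * ((w t x * P t x) * (w t x * P t x))) y))).
- have [-> ->] := J_bc t0.
  by rewrite !prim01_0 -/(G t) -/(E t); ring.
- exact: d2.
- move=> y yI; apply: is_D01_eq.
    apply: is_D01D.
      apply: is_D01M => //; first exact: is_D01_cst.
      apply: is_D01M => //; first exact: J_D01.
      by apply: is_D01M => //; [exact: P_D01|exact: q_D01].
    apply: is_D01D.
      by apply: is_D01M => //; [exact: is_D01_cst|exact: is_D01_prim].
    by apply: is_D01M => //; [exact: is_D01_cst|exact: is_D01_prim].
  by rewrite /g /J /=; field.
- exact: in01_1.
Qed.

Let E_ge0 t : 0 <= E t.
Proof.
apply: prim01_ge0; first exact: in01_1.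
by move=> y yI; apply: mulr_ge0; [exact/ltW/rho_gt0|rewrite -expr2 sqr_ge0].
Qed.

Let K_gt0 t : 0 < t -> 0 < K t.
Proof.
move=> t0.
have [_ _ bP _] := time_derivativeM
  (time_derivative_cst (diff01_cst (- 2^-1))) (time_derivative_prim w_dt wt_diff).
have [C /nbhs_singleton hC] := bP _ t0.
have dP := P_diff t0.
have c0 : 0 < d * expR (- C) by rewrite mulr_gt0// expR_gt0.
apply: lt_le_trans c0 _.
rewrite -[X in X <= _]mulr1 -(prim01_cst _ in01_1); apply: ler_prim01.
- exact: diff01_cst.
- exact: diff01M.
- exact: in01_1.
- move=> y yI; apply: ler_pM => //; [exact: ltW|exact: rho_ge|].
  by rewrite ler_expR; have := hC _ yI; rewrite ler_norml => /andP[].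
Qed.

(** This fixes the decay rate: [E <= (4 / d) Q] and [Q <= M G], where [Q] is the integral of
    [J_x^2], combine into the constant [2 d / M]. *)
Let E_le_G t : 0 < t -> 2 * d / M * E t <= 8 * G t.
Proof.
move=> t0; have dP := P_diff t0; have dq := q_diff t0; have dw := w_diff t0.
have drPq : diff01 (fun x => rho x * (P t x * q t x)).
  by apply: diff01M => //; exact: diff01M.
have drPq' : diff01 (fun x => rho x * (P t x * q t x) ^+ 2).
  by apply: diff01M => //; apply: diff01X; exact: diff01M.
set Q := prim01 (fun x => (rho x * (P t x * q t x)) ^+ 2) 1.
have QG : Q <= M * G t.
  rewrite -prim01Z ?in01_1//; apply: ler_prim01.
  - exact: diff01X.
  - by apply: diff01M => //; exact: diff01_cst.
  - exact: in01_1.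
  - move=> y yI; rewrite exprMn expr2 -mulrA; apply: ler_wpM2r; last exact: rho_le.
    by apply: mulr_ge0; [exact/ltW/rho_gt0|exact: sqr_ge0].
(* Poincare inequality for the flux, using [E = 4 int J^2 / rho] *)
have EQ : E t <= 4 / d * Q.
  rewrite -[X in _ <= X]mulr1 -(prim01_cst _ in01_1); apply: ler_prim01.
  - by apply: diff01M => //; apply: diff01M; exact: diff01M.
  - exact: diff01_cst.
  - exact: in01_1.
  - move=> y yI; have r0 := rho_gt0 yI.
    have -> : rho y * (w t y * P t y * (w t y * P t y)) = 4 * J t y ^+ 2 / rho y.
      by rewrite /J; field; rewrite gt_eqF.
    have JQ := sqr_le_prim01 (fun z zI => J_D01 t0 zI) drPq (J_bc t0).1 yI.
    rewrite ler_pdivrMr//.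
    have -> : 4 / d * Q * rho y = 4 * Q * (rho y / d) by ring.
    have : 1 <= rho y / d by rewrite ler_pdivlMr// mul1r rho_ge.
    rewrite -/Q in JQ; have := sqr_ge0 (J t y); nra.
have -> : 8 * G t = 2 * d / M * (4 / d * (M * G t)).
  by field; rewrite !gt_eqF.
apply: ler_wpM2l; first by rewrite divr_ge0 ?mulr_ge0// ltW.
by apply: le_trans EQ _; apply: ler_wpM2l => //; rewrite divr_ge0// ltW.
Qed.

(** Shifting the exponent [p] by a constant scales [E] and [K^2] by the same factor, so the quotient
    does not see the base point of the primitive, and the [q t 0] terms of [E'] and [K'] cancel in
    [H']. *)
Let H (t : R) : R := E t / K t ^+ 2.

Let H_dt (t : R) : 0 < t -> is_derive t 1 H (- 8 * G t / K t ^+ 2).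
Proof.
move=> t0; have K0 := K_gt0 t0.
have K2 : is_derive t 1 (fun r => (K r ^+ 2)^-1) (2 * q t 0 / K t ^+ 2).
  have d1 := is_deriveX 2 (K_dt t0).
  have k2 : (K ^+ 2) t != 0 by rewrite fctE gt_eqF// exprn_gt0.
  have := is_deriveV k2 d1.
  rewrite /GRing.scale/= !fctE => h; apply: is_derive_eq h _.
  by field; rewrite gt_eqF.
have := is_deriveM (E_dt t0) K2; rewrite /GRing.scale /= => h.
apply: is_derive_eq h _.
by field; rewrite gt_eqF.
Qed.

Let H_ge0 t : 0 <= H t.
Proof. by rewrite /H divr_ge0// sqr_ge0. Qed.

Let H_decay t : 1 <= t ->
  H t <= expR (2 * d / M) * H 1 * expR (- (2 * d / M * t)).
Proof.
move=> t1; set l := 2 * d / M.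
(* Gronwall: [F] is nonincreasing by [E_le_G]. The comparison starts at time 1 because the equations
   hold at positive times only. *)
pose F r := expR (l * r) * H r.
have dF (r : R) : 0 < r -> is_derive r 1 F (expR (l * r) * (l * H r - 8 * G r / K r ^+ 2)).
  move=> r0.
  have dl : is_derive r 1 (fun r : R => l * r) l.
    by apply: is_derive_eq; rewrite /GRing.scale/= mulr1.
  have de : is_derive r 1 (fun r : R => expR (l * r)) (expR (l * r) * l).
    exact: (is_derive1_comp (f := expR) (g := fun r => l * r)).
  have := is_deriveM de (H_dt r0); rewrite /GRing.scale/= => h.
  by apply: is_derive_eq h _; ring.
suff : F t <= F 1.
  rewrite /F mulr1 => h; rewrite expRN ler_pdivlMr ?expR_gt0//.
  by rewrite mulrC.
rewrite -lerN2.
have dNF (r : R) : 0 < r -> is_derive r 1 (fun x => - F x)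
    (- (expR (l * r) * (l * H r - 8 * G r / K r ^+ 2))).
  by move=> r0; have h := dF _ r0; exact: is_deriveN.
have gt0 r : r \in `]1, +oo[ -> 0 < r.
  by rewrite in_itv/= andbT; apply: lt_trans.
apply: (@ger0_derive1_ndecry _ (fun x => - F x) 1) => //.
- by move=> r /gt0 /dNF[].
- move=> r /gt0 r0; have [_ e] := dNF _ r0; rewrite derive1E e oppr_ge0.
  rewrite pmulr_rle0 ?expR_gt0// subr_le0 /H mulrA ler_pM2r; last first.
    by rewrite invr_gt0 exprn_gt0// K_gt0.
  exact: E_le_G.
- apply/subspace_continuousP => r /=; rewrite in_itv/= andbT => r1.
  apply: cvg_within_filter.
  apply: (@differentiable_continuous R R^o R^o r (fun x => - F x)).
  apply/derivable1_diffP.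
  by have [] := dNF r (lt_le_trans ltr01 r1).
Qed.

(** [E] integrates [w^2] against the weight [rho P^2]; smallness of [H] bounds [P / K] from below,
    which allows the weight to be dropped. *)
Let w_le_H t : 0 < t -> H t <= d / M ^+ 2 ->
  prim01 (fun x => w t x ^+ 2) 1 <= 4 * M ^+ 2 / d * H t.
Proof.
move=> t0 Ht; have K0 := K_gt0 t0.
have dP := P_diff t0; have dw := w_diff t0.
have dP1 : diff01 (fun x => - 2^-1 * (w t x * P t x)).
  by apply: diff01M; [exact: diff01_cst|exact: diff01M].
have dwP : diff01 (fun x => rho x * (w t x * P t x * (w t x * P t x))).
  by apply: diff01M => //; apply: diff01M; exact: diff01M.
have P1E : prim01 (fun z => (- 2^-1 * (w t z * P t z)) ^+ 2) 1 <= E t / (4 * d).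
  rewrite mulrC -prim01Z ?in01_1//; apply: ler_prim01.
  - exact: diff01X.
  - by apply: diff01M => //; exact: diff01_cst.
  - exact: in01_1.
  - move=> y yI; rewrite [X in _ <= X]mulrC ler_pdivlMr ?mulr_gt0//.
    have := rho_ge yI; have := sqr_ge0 (w t y * P t y).
    nra.
have P_ge x : x \in `[0, 1] -> K t / (2 * M) <= P t x.
  move=> xI.
  (* With this [k] both terms of the oscillation bound are at most [k]: the second one needs
     [E <= 16 d k^2], which is the assumption [H t <= d / M ^+ 2]. *)
  pose k := K t / (4 * M).
  have k0 : 0 < k by rewrite divr_gt0// mulr_gt0.
  have osc y : y \in `[0, 1] -> P t y <= P t x + K t / (2 * M).
    move=> yI; apply: le_trans (osc_le_prim01 (fun z zI => P_D01 t0 zI) dP1 k0 xI yI) _.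
    rewrite lerD2l.
    have -> : K t / (2 * M) = k + k by rewrite /k; field; rewrite gt_eqF.
    have k4 : 0 < 4 * k by apply: mulr_gt0.
    rewrite lerD2l ler_pdivrMr//; apply: (le_trans P1E).
    rewrite ler_pdivrMr ?mulr_gt0//.
    move: Ht; rewrite /H ler_pdivrMr ?exprn_gt0// => h; apply: le_trans h _.
    have -> : d / M ^+ 2 * K t ^+ 2 = k * (4 * k) * (4 * d).
      by rewrite /k; field; rewrite gt_eqF.
    by [].
  (* [K] is at most [M] times the maximum of [P], and the oscillation costs only half of [K]. *)
  have : K t <= M * (P t x + K t / (2 * M)).
    rewrite -[X in _ <= X]mulr1 -(prim01_cst _ in01_1); apply: ler_prim01.
    - exact: diff01M.
    - exact: diff01_cst.
    - exact: in01_1.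
    - move=> y yI; apply: ler_pM; [exact/ltW/rho_gt0|exact/ltW|exact: rho_le|exact: osc].
  have -> : M * (P t x + K t / (2 * M)) = M * P t x + K t / 2.
    by field; rewrite gt_eqF.
  rewrite ler_pdivrMr ?mulr_gt0//; lra.
have -> : 4 * M ^+ 2 / d * H t = 4 * M ^+ 2 / (d * K t ^+ 2) * E t.
  by rewrite /H; field; rewrite !gt_eqF.
rewrite -prim01Z ?in01_1//; apply: ler_prim01.
- exact: diff01X.
- by apply: diff01M => //; exact: diff01_cst.
- exact: in01_1.
- move=> y yI.
  (* The factors [rho y / d] and [P t y / (K t / (2 * M))] are both at least 1. *)
  have -> : 4 * M ^+ 2 / (d * K t ^+ 2) * (rho y * (w t y * P t y * (w t y * P t y)))
     = (rho y / d) * (P t y / (K t / (2 * M))) ^+ 2 * w t y ^+ 2.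
    by field; rewrite !gt_eqF.
  have a1 : 1 <= rho y / d by rewrite ler_pdivlMr// mul1r rho_ge.
  have a2 : 1 <= P t y / (K t / (2 * M)).
    by rewrite ler_pdivlMr ?mul1r ?P_ge// divr_gt0// mulr_gt0.
  rewrite -[X in X <= _]mul1r; apply: ler_wpM2r; first exact: sqr_ge0.
  by rewrite -[X in X <= _]mulr1; apply: ler_pM => //; rewrite exprn_ege1.
Qed.

Lemma conservation_law_decay :
  prim01 (fun x => w t x ^+ 2) 1 @[t --> +oo] --> 0.
Proof.
have l0 : 0 < 2 * d / M by rewrite divr_gt0// mulr_gt0.
have H0 : H t @[t --> +oo] --> 0.
  apply: (@squeeze_cvgr _ _ _ _ (fun=> 0)
    (fun t => expR (2 * d / M) * H 1 * expR (- (2 * d / M * t)))).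
  - near=> t; rewrite H_ge0/=; apply: H_decay.
    by near: t; apply: nbhs_pinfty_ge; rewrite num_real.
  - exact: cvg_cst.
  - rewrite -[X in _ --> X](mulr0 (expR (2 * d / M) * H 1)).
    apply: cvgM; first exact: cvg_cst.
    apply: (@cvg_comp _ _ _ (fun t : R => 2 * d / M * t) (fun z => expR (- z))
      _ (pinfty_nbhs R)); last exact: cvgr_expR.
    exact: gt0_cvgMry.
apply: (@squeeze_cvgr _ _ _ _ (fun=> 0) (fun t => 4 * M ^+ 2 / d * H t)).
- near=> t; apply/andP; split.
    by apply: prim01_ge0; [exact: in01_1|move=> y _; exact: sqr_ge0].
  apply: w_le_H.
    by near: t; apply: nbhs_pinfty_gt; rewrite num_real.
  near: t; apply: (cvgr_le 0 H0); by rewrite divr_gt0// exprn_gt0.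
- exact: cvg_cst.
- by rewrite -[X in _ --> X](mulr0 (4 * M ^+ 2 / d)); apply: cvgM => //; exact: cvg_cst.
Unshelve. all: by end_near. Qed.

End decay.

(** * Smooth functions and square-integrable classes *)

Section smooth.
Context {R : realType}.
Implicit Types (f g : R -> R).

(** Derivatives are chosen existentially and constrained on [[0, 1]] only, so closure under sums and
    products goes by induction, without formulas for iterated [D01]. *)
Fixpoint Cn01 n f : Prop :=
  if n is m.+1 then
    exists2 f', forall x, x \in `[0, 1] -> is_D01 f x (f' x) & Cn01 m f'
  else True.

Lemma eq_Cn01 n f g : {in `[0, 1], f =1 g} -> Cn01 n f -> Cn01 n g.
Proof.
case: n => // n fg [f' df cf]; exists f' => // x xI.
exact: eq_is_D01 fg (df _ xI).
Qed.

Lemma Cn01S n f : Cn01 n.+1 f -> Cn01 n f.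
Proof. by elim: n f => // n IH f [f' df cf]; exists f' => //; exact: IH. Qed.

Lemma Cn01D n f g : Cn01 n f -> Cn01 n g -> Cn01 n (fun x => f x + g x).
Proof.
elim: n f g => // n IH f g [f' df cf] [g' dg cg].
exists (fun x => f' x + g' x); last exact: IH.
by move=> x xI; apply: is_D01D; [exact: df|exact: dg].
Qed.

Lemma Cn01M n f g : Cn01 n f -> Cn01 n g -> Cn01 n (fun x => f x * g x).
Proof.
elim: n f g => // n IH f g [f' df cf] [g' dg cg].
exists (fun x => f' x * g x + f x * g' x).
  by move=> x xI; apply: is_D01M => //; [exact: df|exact: dg].
apply: Cn01D; apply: IH => //; apply: Cn01S.
  by exists g'.
by exists f'.
Qed.

Lemma Cn01_cst n (c : R) : Cn01 n (fun=> c).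
Proof.
elim: n c => // n IH c; exists (fun=> 0) => // x _; exact: is_D01_cst.
Qed.

Lemma smooth01P f : smooth01 f <-> forall n, Cn01 n f.
Proof.
split=> [sf n|cf n].
  elim: n f sf => // n IH f sf; exists (D01 f).
    by move=> x xI; apply/derivable01P => //; exact: (sf 0%N).
  by apply: IH => m x xI; have := sf m.+1 _ xI; rewrite iterSr.
move: {cf}(cf n.+1); elim: n f => [|n IH] f [f' df cf] x xI.
  by have [] := is_D01_unique xI (df _ xI).
rewrite iterSr; apply: IH => //.
(* [f'] and [D01 f] agree on [[0, 1]] but possibly not elsewhere. *)
by apply: (@eq_Cn01 n.+1 f' _ _ cf) => y yI; rewrite (D01E yI (df _ yI)).
Qed.

Lemma smooth01_is_D01 f x : smooth01 f -> x \in `[0, 1] ->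
  is_D01 f x (D01 f x).
Proof. by move=> sf xI; apply/derivable01P => //; exact: (sf 0%N). Qed.

Lemma smooth01_D01 f : smooth01 f -> smooth01 (D01 f).
Proof. by move=> sf n x xI; have := sf n.+1 _ xI; rewrite iterSr. Qed.

End smooth.

Section L2_unit_interval.
Context {R : realType}.
Implicit Types (f g : R -> R) (u : L2 R).

Lemma ae_in01 : {ae mu01 R, forall x, x \in `[0, 1]}.
Proof.
exists (~` `[0, 1]%classic); split => //.
- exact: measurableC.
- by rewrite /mu01 /= /mrestr setICl measure0.
Qed.

Lemma diff01_measurable g : diff01 g ->
  measurable_fun (`[0, 1] : set R) (g : measurableTypeR R -> measurableTypeR R).
Proof.
move=> dg; apply: subspace_continuous_measurable_fun => //.
exact: diff01_continuous.
Qed.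

Lemma measurable_patch01 g : diff01 g ->
  measurable_fun setT (g \_ `[0, 1] : measurableTypeR R -> measurableTypeR R).
Proof.
by move=> dg; apply/(measurable_restrictT _ _).1 => //; exact: diff01_measurable.
Qed.

(** The bridge from almost-everywhere classes to the calculus above: a differentiable representative
    reduces the norm to [prim01]. *)
Lemma L2normE f g : measurable_fun setT (f : measurableTypeR R -> measurableTypeR R) ->
  diff01 g -> f = g %[ae mu01 R] ->
  L2norm f = (Num.sqrt (prim01 (fun x => g x ^+ 2) 1))%:E.
Proof.
move=> mf dg fg.
have dg2 : diff01 (fun x => g x ^+ 2) by exact: diff01X.
suff H : (\int[mu01 R]_x (`|f x| `^ 2)%:E = (prim01 (fun x => g x ^+ 2) 1)%:E)%E.
  rewrite /L2norm unlock.
  rewrite H poweR_EFin powR12_sqrt//.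
  by apply: prim01_ge0; [exact: in01_1|move=> y _; exact: sqr_ge0].
rewrite (_ : (prim01 _ 1)%:E =
   (\int[@lebesgue_measure R]_(x in `[0%R, 1%R]) (g x ^+ 2)%:E)%E); last first.
  rewrite /prim01 /Rintegral fineK//; apply: integrable_fin_num => //.
  by apply: diff01_integrable => //; exact: in01_1.
rewrite [RHS](@eq_measure_integral _ _ _ _ (mu01 R)); last first.
  by move=> A mA AI; rewrite /mu01/= /mrestr setIidl.
rewrite [RHS]integral_mkcond.
apply: ae_eq_integral => //.
- apply/measurable_EFinP.
  apply: (measurableT_comp (measurable_powR _)) => //.
  exact: measurableT_comp.
- apply/(measurable_restrictT _ _).1 => //; apply/measurable_EFinP.
  exact: diff01_measurable.
(* Off [[0, 1]] the two integrands may differ, but that set is null for [mu01]. *)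
- have H2 := ae_in01.
  apply: (@filterS2 _ _ (ae_filter_ringOfSetsType (mu01 R)) _ _ _ _ H2 fg).
  move=> x xI /= fgx _.
  by rewrite patchE mem_setE xI fgx// powR_mulrn// real_normK// num_real.
Qed.

Lemma L2_measurable u : measurable_fun setT (u : measurableTypeR R -> measurableTypeR R).
Proof. exact: measurable_funPT. Qed.

Lemma L2_exists g : diff01 g -> exists u : L2 R, (u : R -> R) = g %[ae mu01 R].
Proof.
move=> dg.
(* [g] is arbitrary outside [[0, 1]]; cutting it off there makes it measurable on the line without
   changing it almost everywhere for [mu01]. *)
pose h : {mfun measurableTypeR R >-> measurableTypeR R} :=
  HB.pack (g \_ `[0, 1]) (@isMeasurableFun.Build _ _ (measurableTypeR R)
    (measurableTypeR R) _ (measurable_patch01 dg)).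
pose k : {mfun_ mu01 R, measurableTypeR R >-> measurableTypeR R} :=
  (\pi_({mfun_ mu01 R, measurableTypeR R >-> measurableTypeR R}) h)%qT.
have kg : (k : R -> R) = g %[ae mu01 R].
  have : (repr k == h
      %[mod {mfun_ mu01 R, measurableTypeR R >-> measurableTypeR R}])%qT.
    by rewrite reprK.
  rewrite eqmodE => /asboolP hk.
  apply: (@filterS2 _ _ (ae_filter_ringOfSetsType (mu01 R)) _ _ _ _ ae_in01 hk).
  move=> x xI /= /(_ Logic.I) e _.
  transitivity (h x); first exact: e.
  by rewrite /h /= patchE mem_setE xI.
have fk : finite_norm (mu01 R) 2%:E k.
  have mk : measurable_fun setT (k : measurableTypeR R -> measurableTypeR R).
    exact: measurable_funPT.
  by rewrite /finite_norm -/(L2norm k) (L2normE mk dg kg) ltry.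
pose u : L2 R := HB.pack k (@isFinLebesgue.Build _ _ _ _ _ (lee1n 2) k fk).
by exists u.
Qed.

Lemma L2_eq (u v : L2 R) : (u : R -> R) = v %[ae mu01 R] -> u = v.
Proof.
case: u => u cu; case: v => v cv /= uv.
have e : u = v.
  rewrite -[u]reprK -[v]reprK; apply/eqP; rewrite eqmodE; apply/asboolP.
  exact: uv.
(* Only the two proofs of finite norm remain to be identified. *)
move: cu cv {uv}; rewrite e => -[[fu]] [[fv]].
by rewrite (Prop_irrelevance fu fv).
Qed.
End L2_unit_interval.

(** * The Burgers flow *)

Section burgers.
Context {R : realType}.
Implicit Types (f g : R -> R).

Lemma within_continuous_snd01 (A : set R) g : diff01 g ->
  {within A `*` `[0, 1], continuous (fun p : R * R => g p.2)}.
Proof.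
move=> /diff01_continuous /subspace_continuousP cg.
apply/subspace_continuousP => -[t x] /= [tA xI].
apply: (@cvg_comp _ _ _ (fun p : R * R => p.2) g _ (within `[0, 1] (nbhs x))).
  move=> B /= hB.
  have h : \forall p \near ((t, x) : R * R), `[0, 1]%classic p.2 -> B p.2.
    exact: (@cvg_snd R R (nbhs t) (nbhs x) _ _ hB).
  by apply: filterS h => p hp [_ pI]; exact: hp.
exact: cg.
Qed.

(** The bound comes from compactness of [[t / 2, 2 t] x [0, 1]], a box that avoids the initial
    time. *)
Lemma locally_bounded01_within (h : R -> R -> R) :
  {within `]0, +oo[ `*` `[0, 1], continuous (fun p : R * R => h p.1 p.2)} ->
  locally_bounded01 h.
Proof.
move=> ch t t0.
have sub : (`[t / 2, 2 * t] `*` `[0, 1] : set (R * R)) `<=` `]0, +oo[ `*` `[0, 1].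
  move=> [r x] /= [+ xI]; rewrite !in_itv/= => /andP[tr _]; split => //.
  by rewrite andbT (lt_le_trans _ tr)// divr_gt0.
have /compact_bounded[M [_ hM]] :
    compact ((fun p : R * R => h p.1 p.2) @` (`[t / 2, 2 * t] `*` `[0, 1])).
  apply: continuous_compact; first exact: continuous_subspaceW sub ch.
  by apply: compact_setX; exact: segment_compact.
exists (M + 1); near=> r => x xI.
apply: (hM (M + 1)); rewrite ?ltrDl//; exists (r, x) => //; split => //=.
apply: subset_itv_oo_cc; near: r; apply: near_in_itvoo.
by rewrite in_itv/=; lra.
Unshelve. all: by end_near. Qed.

Variables (V : R -> R) (mu : R) (e : R -> R).
Hypothesis V_smooth : smooth01 V.
Hypothesis e_eigen : neumann_eigenpair V mu e.
Hypothesis e_gt0 : forall x, x \in `[0, 1] -> 0 < e x.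

Let s x := - 2 * (D01 e x / e x).
Let s' x := s x ^+ 2 / 2 - 2 * (V x - mu).

Let V_D01 x : x \in `[0, 1] -> is_D01 V x (D01 V x).
Proof. exact: smooth01_is_D01. Qed.

Let e_D01 x : x \in `[0, 1] -> is_D01 e x (D01 e x).
Proof.
by move=> xI; apply/derivable01P => //; apply: (eigenpair_derivable e_eigen _).1.
Qed.

Let e'_D01 x : x \in `[0, 1] -> is_D01 (D01 e) x ((V x - mu) * e x).
Proof.
move=> xI; apply: is_D01_eq.
  by apply/derivable01P => //; apply: (eigenpair_derivable e_eigen _).2.
have := eigenpair_eq e_eigen xI; lra.
Qed.

(** The equation [e'' = (V - mu) e] becomes a Riccati equation for the logarithmic derivative of
    [e]. *)
Lemma drift_D01 x : x \in `[0, 1] -> is_D01 s x (s' x).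
Proof.
move=> xI; have e0 := e_gt0 xI; apply: is_D01_eq.
  apply: is_D01M => //; first exact: is_D01_cst.
  apply: is_D01M => //; first exact: e'_D01.
  by apply: is_D01V => //; [rewrite gt_eqF|exact: e_D01].
by rewrite /s' /s; field; rewrite gt_eqF.
Qed.

(** Differentiating the Riccati equation removes [mu] and leaves [s'' = s s' - 2 V'], the steady
    Burgers equation. *)
Lemma drift'_D01 x : x \in `[0, 1] ->
  is_D01 s' x (s x * s' x - 2 * D01 V x).
Proof.
move=> xI; apply: is_D01_eq.
  apply: is_D01D.
    apply: is_D01M => //; last exact: is_D01_cst.
    by apply: is_D01M => //; exact: drift_D01.
  apply: is_D01N; apply: is_D01M => //; first exact: is_D01_cst.
  by apply: is_D01D; [exact: V_D01|exact: is_D01_cst].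
by rewrite /=; field.
Qed.

(** Bootstrap: the Riccati equation writes [s'] as a polynomial in [s] and [V], so each order of
    differentiability of [s] yields the next. *)
Lemma drift_smooth : smooth01 s.
Proof.
apply/smooth01P; elim=> // n IH; exists s'; first exact: drift_D01.
apply: Cn01D.
  by apply: Cn01M; [exact: Cn01M|exact: Cn01_cst].
apply: (@eq_Cn01 _ n (fun x => - 2 * (V x + - mu))).
  by move=> x _; rewrite mulNr.
apply: Cn01M; first exact: Cn01_cst.
by apply: Cn01D; [exact: (smooth01P V).1|exact: Cn01_cst].
Qed.

Lemma drift_bc : s 0 = 0 /\ s 1 = 0.
Proof. by have [h0 h1] := eigenpair_bc e_eigen; rewrite /s h0 h1 mul0r mul0r mulr0. Qed.

Let D01s x : x \in `[0, 1] -> D01 s x = s' x.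
Proof. by move=> xI; apply: D01E => //; exact: drift_D01. Qed.

Lemma drift_stationary : burgers_classical V (fun=> s).
Proof.
have s_diff : diff01 s by exact: is_D01_diff01 drift_D01.
split.
- by move=> t _; exact: drift_smooth.
- by move=> t x _ _; exact: derivable_cst.
- split.
  + exact: within_continuous_snd01.
  + rewrite (_ : (fun p => _) = (fun=> 0)).
      by apply: continuous_subspaceT => ?; exact: cst_continuous.
    by apply/funext => p; rewrite derive1_cst.
  + apply: (@within_continuous_snd01 _ (D01 s)).
    apply: (@is_D01_diff01 _ _ (D01 (D01 s))) => x xI.
    exact/smooth01_is_D01/xI/smooth01_D01/drift_smooth.
  + apply: (@within_continuous_snd01 _ (D01 (D01 s))).
    apply: (@is_D01_diff01 _ _ (D01 (D01 (D01 s)))) => x xI.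
    exact/smooth01_is_D01/xI/smooth01_D01/smooth01_D01/drift_smooth.
- move=> t x _ xI; rewrite derive1_cst add0r D01s//.
  have -> : D01 (D01 s) x = D01 s' x by apply: eq_D01 => // y; exact: D01s.
  by rewrite (D01E xI (drift'_D01 xI)); ring.
- by move=> t _; exact: drift_bc.
Qed.

Lemma burgers_classical_decay v : burgers_classical V v ->
  prim01 (fun x => (v t x - s x) ^+ 2) 1 @[t --> +oo] --> 0.
Proof.
move=> [vs vt [vc vtc _ _] veq vbc].
have ediff : diff01 e by exact: is_D01_diff01 e_D01.
pose rho x := e x ^+ 2.
have rho_cont : {within `[0, 1], continuous rho}.
  by apply: diff01_continuous; exact: diff01X.
(* The extrema of [rho] on the interval provide the constants [d] and [M] of the decay section. *)
have [a aI rho_ge] := EVT_min ler01 rho_cont.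
have [b bI rho_le] := EVT_max ler01 rho_cont.
have v_D01 t x : 0 < t -> x \in `[0, 1] -> is_D01 (v t) x (D01 (v t) x).
  by move=> t0 xI; apply: smooth01_is_D01 => //; exact: vs.
have v'_D01 t x : 0 < t -> x \in `[0, 1] ->
    is_D01 (D01 (v t)) x (D01 (D01 (v t)) x).
  by move=> t0 xI; apply: smooth01_is_D01 => //; exact/smooth01_D01/vs.
have s_diff : diff01 s by exact: is_D01_diff01 drift_D01.
apply: (@conservation_law_decay _ rho s (fun t x => v t x - s x)
  (fun t x => derive1 (v^~ x) t)
  (fun t x => (v t x ^+ 2 - s x ^+ 2) / 4 - (D01 (v t) x - s' x) / 2)
  (rho a) (rho b)) => //.
- by rewrite /rho exprn_gt0// e_gt0.
- move=> x xI; have e0 := e_gt0 xI; apply: is_D01_eq.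
    by apply: is_D01M => //; exact: e_D01.
  by rewrite /s /rho; field; rewrite gt_eqF.
- split.
  + move=> t t0; apply: diff01D; last exact: diff01N.
    exact: is_D01_diff01 (fun x => v_D01 t x t0).
  + move=> t x t0 xI; rewrite -[derive1 _ _]subr0.
    apply: is_deriveB; rewrite derive1E; apply: derivableP; exact: vt.
  + apply: locally_bounded01D; first exact: locally_bounded01_within vc.
    by case: (time_derivative_cst (diff01N s_diff)).
  + exact: (@locally_bounded01_within (fun t x => derive1 (v^~ x) t)).
- move=> t t0 x xI.
  have d3 : is_D01 (D01 (D01 (v t))) x (D01 (D01 (D01 (v t))) x).
    by apply: smooth01_is_D01 => //; exact/smooth01_D01/smooth01_D01/vs.
  have dV : is_D01 (D01 V) x (D01 (D01 V) x).
    by apply: smooth01_is_D01 => //; exact/smooth01_D01.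
  (* Differentiability of [v_t] in space is read off from the equation, whose other terms are smooth
     in [x]. *)
  eexists; apply: (@eq_is_D01 _ (fun x => D01 (D01 (v t)) x + 2 * D01 V x +
     - (v t x * D01 (v t) x))).
    by move=> y yI /=; rewrite -(veq _ _ t0 yI); ring.
  apply: is_D01D; last first.
    by apply: is_D01N; apply: is_D01M => //; [exact: v_D01|exact: v'_D01].
  apply: is_D01D; first exact: d3.
  by apply: is_D01M => //; [exact: is_D01_cst|exact: dV].
- by move=> t t0; have [-> ->] := vbc _ t0; have [-> ->] := drift_bc; rewrite subr0.
- move=> t x t0 xI; apply: is_D01_eq.
    by apply: is_D01D; [exact: v_D01|apply: is_D01N; exact: drift_D01].
  by rewrite /=; field.
- move=> t x t0 xI; apply: is_D01_eq.
    apply: is_D01D.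
      apply: is_D01M => //; last exact: is_D01_cst.
      apply: is_D01D; first by apply: is_D01M => //; exact: v_D01.
      by apply: is_D01N; apply: is_D01M => //; exact: drift_D01.
    apply: is_D01N; apply: is_D01M => //; last exact: is_D01_cst.
    by apply: is_D01D; [exact: v'_D01|apply: is_D01N; exact: drift'_D01].
  (* Solving the equation for [v_t] turns [q_x = - v_t / 2] into an algebraic identity. *)
  have -> : derive1 (v^~ x) t = D01 (D01 (v t)) x + 2 * D01 V x - v t x * D01 (v t) x.
    by rewrite -veq//; ring.
  by rewrite /=; field.
Qed.

Lemma L2norm_decay (u : R -> L2 R) (s0 : L2 R) v :
  (s0 : R -> R) = s %[ae mu01 R] ->
  (forall t, 0 < t -> u t = v t %[ae mu01 R]) -> burgers_classical V v ->
  L2norm (u t \- s0) @[t --> +oo] --> 0%E.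
Proof.
move=> s0s uv vB.
have s_diff : diff01 s by exact: is_D01_diff01 drift_D01.
have H : (Num.sqrt (prim01 (fun x => (v t x - s x) ^+ 2) 1))%:E @[t --> +oo] --> 0%:E.
  apply: cvg_EFin; first exact: nearW.
  have h := cvg_comp _ _ (burgers_classical_decay vB) (@sqrt_continuous R 0).
  by rewrite sqrtr0 in h.
apply: cvg_trans H; apply: near_eq_cvg; near=> t.
have t0 : 0 < t by near: t; apply: nbhs_pinfty_gt; rewrite num_real.
rewrite (@L2normE _ _ (fun x => v t x - s x))//.
- by apply: measurable_funB; exact: L2_measurable.
- apply: diff01D; last exact: diff01N.
  apply: (@is_D01_diff01 _ _ (D01 (v t))) => x xI.
  by apply: smooth01_is_D01 => //; exact: (burgers_smooth vB).
- apply: (@filterS2 _ _ (ae_filter_ringOfSetsType (mu01 R)) _ _ _ _ s0s (uv t t0)).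
  by move=> x /= /(_ Logic.I) hs /(_ Logic.I) hv _; rewrite hs hv.
Unshelve. all: by end_near. Qed.

End burgers.

(** * Separation of classes by the norm, and the unique attracting steady state *)

Lemma L2norm0_eq (R : realType) (u v : L2 R) : L2norm (u \- v) = 0%E -> u = v.
Proof.
move=> h; apply: L2_eq.
have m : measurable_fun setT (EFin \o (u \- v : measurableTypeR R -> measurableTypeR R)).
  by apply/measurable_EFinP; apply: measurable_funB; exact: L2_measurable.
have := Lnorm_eq0_eq0 m _ h.
have p2 : (0 < 2%:E :> \bar R)%E by rewrite lte_fin.
move=> /(_ p2).
apply: (@filterS _ _ (ae_filter_ringOfSetsType (mu01 R))) => x /= /(_ Logic.I) [] + _.
by move=> /eqP; rewrite subr_eq0 => /eqP.
Qed.

Lemma L2norm_subrr (R : realType) (u : L2 R) : L2norm (u \- u) = 0%E.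
Proof.
rewrite /L2norm (_ : EFin \o (u \- u) = cst 0%E) ?Lnorm0//.
by apply/funext => x /=; rewrite subrr.
Qed.

Unset Implicit Arguments.

Theorem mainTheorem1 (R : realType) (V : R -> R) (mu0 : R) (e0 : R -> R)
    (Phi : R -> L2 R -> L2 R) :
  smooth01 V ->
  (forall x : R, x \in `[0, 1] -> 0 < V x) ->
  ground_state V mu0 e0 ->
  burgers_flow V Phi ->
  exists s0 : L2 R,
    [/\ (s0 : R -> R) = (fun x => - 2 * (D01 e0 x / e0 x)) %[ae mu01 R],
        forall s : L2 R, steady_state Phi s <-> s = s0 &
        forall u0 : L2 R, L2norm (Phi t u0 \- s0) @[t --> +oo] --> 0%E].
Proof.
move=> V_smooth _ [e_eigen _ _ e_gt0] flow.
have [s0 s0E] := L2_exists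
  (is_D01_diff01 (fun x => @drift_D01 _ V mu0 e0 e_eigen e_gt0 x)).
exists s0.
have cvg0 u0 : L2norm (Phi t u0 \- s0) @[t --> +oo] --> 0%E.
  (* The orbit coincides with itself, so [burgers_flow] read from right to left makes it a
     solution. *)
  have [_ _ [v uv vB]] := (flow u0 (Phi^~ u0)).2 (fun _ _ => erefl).
  exact: (L2norm_decay V_smooth e_eigen e_gt0 s0E uv vB).
split=> // s; split=> [steady|-> t t0].
  apply: L2norm0_eq.
  (* For a steady [s] this norm is constant in [t >= 0], and uniqueness of limits forces it to be
     0. *)
  have h : L2norm (Phi t s \- s0) @[t --> +oo] --> L2norm (s \- s0).
    apply: cvg_near_cst; near=> t.
    have t0 : 0 <= t by near: t; apply: nbhs_pinfty_ge; rewrite num_real.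
    by rewrite steady.
  exact: (cvg_unique _ h (cvg0 s)).
(* The constant curve [s0] is a solution, so [burgers_flow] read from left to right identifies it
   with the orbit of [s0]. *)
apply/esym; apply: ((flow s0 (fun=> s0)).1 _ t t0); split=> //.
- by move=> r _; rewrite L2norm_subrr; exact: cvg_cst.
- exists (fun=> fun x => - 2 * (D01 e0 x / e0 x)); first by [].
  exact: drift_stationary V_smooth e_eigen e_gt0.
Unshelve. all: by end_near. Qed.
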